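(* Let $\mathcal{R}$ be a commutative ring, let $p\ge1$ and $d_1,\ldots,d_p\ge1$ be integers, let $\mathbf{a}^{(i)}\in\mathcal{R}^{d_i}$ for $i=1,\ldots,p$, and let $\mathbf{M}_1,\ldots,\mathbf{M}_p$ be $\mathcal{R}$-modules. Then there is an isomorphism of $\mathcal{R}[T_1,\ldots,T_p]$-modules $$\mathcal{F}_{\mathbf{M}_1}(\mathbf{a}^{(1)})\otimes\cdots\otimes\mathcal{F}_{\mathbf{M}_p}(\mathbf{a}^{(p)})\cong\mathcal{F}^{[p]}_{\mathbf{M}_1\otimes\cdots\otimes\mathbf{M}_p}(\mathbf{a}^{(1)},\ldots,\mathbf{a}^{(p)}).$$ In particular, $\mathcal{F}^{[p]}(\mathbf{a}^{(1)},\ldots,\mathbf{a}^{(p)})$ is a free $\mathcal{R}$-module of rank $D=d_1d_2\cdots d_p$.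
   Context: All tensor products are over $\mathcal{R}$. For $\mathbf{a}=(a_1,\ldots,a_d)\in\mathcal{R}^d$, $\mathcal{F}_{\mathbf{M}}(\mathbf{a})$ is the $\mathcal{R}[T]$-module of sequences $(x_n)_{n\ge0}$ in $\mathbf{M}$ with $x_{n+d}=a_1x_{n+d-1}+\cdots+a_dx_n$ for all $n\ge0$, where $T$ acts by the shift $(x_n)\mapsto(x_{n+1})$. For $\mathbf{a}^{(i)}=(a^{(i)}_1,\ldots,a^{(i)}_{d_i})$ and an $\mathcal{R}$-module $\mathbf{L}$, $\mathcal{F}^{[p]}_{\mathbf{L}}(\mathbf{a}^{(1)},\ldots,\mathbf{a}^{(p)})$ is the set of multiple sequences $(x_{n_1,\ldots,n_p})_{n_1,\ldots,n_p\ge0}$ in $\mathbf{L}$ such that for every $i=1,\ldots,p$ and all $n_1,\ldots,n_p\ge0$ $$x_{n_1,\ldots,n_i+d_i,\ldots,n_p}=\sum_{j=1}^{d_i}a^{(i)}_j\,x_{n_1,\ldots,n_i+d_i-j,\ldots,n_p}.$$ It is an $\mathcal{R}[T_1,\ldots,T_p]$-module with $T_i$ acting by the shift of the $i$-th index. When $\mathbf{L}=\mathcal{R}$ the subscript is omitted. On the tensor product, $T_i$ acts by the shift on the $i$-th factor. *)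

(* Defs.v *)
From HB Require Import structures.
From mathcomp Require Import all_boot all_algebra generic_quotient ring_quotient.
From mathcomp Require Import boolp functions.
From mathcomp Require Import finmap monalg.

Set Implicit Arguments.
Unset Strict Implicit.
Unset Printing Implicit Defensive.

Import GRing.Theory.
Local Open Scope ring_scope.
Local Open Scope quotient_scope.

(* The commutative rings below may be trivial (comPzRingType).  The module and
   ring structures of {malg R[K]} and {mpoly R[n]} require 1 != 0, so they are
   set up here for an arbitrary R on the additive group {malg R[K]}. *)

Section FreeModule.
Variables (R : pzRingType) (K : choiceType).

(* Finitely supported functions K -> R: the free R-module on the set K. *)
Definition freemod := {malg R[K]}.
HB.instance Definition _ := GRing.Zmodule.on freemod.

Implicit Types (g h : freemod) (k : K) (c : R).

Definition freemod_scale c g : freemod :=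
  \sum_(k <- msupp g) << c * g@_k *g k >>.

Lemma freemod_scaleE c g k : (freemod_scale c g)@_k = c * g@_k.
Proof.
rewrite {2}[g]monalgE !raddf_sum mulr_sumr.
by apply/eq_bigr=> /= i _; rewrite !mcoeffU mulrnAr.
Qed.

Fact freemod_scaleA c1 c2 g :
  freemod_scale c1 (freemod_scale c2 g) = freemod_scale (c1 * c2) g.
Proof. by apply/malgP=> x; rewrite !freemod_scaleE mulrA. Qed.

Fact freemod_scale1 : left_id 1 freemod_scale.
Proof. by move=> g; apply/malgP=> k; rewrite !freemod_scaleE mul1r. Qed.

Fact freemod_scaleDr : right_distributive freemod_scale +%R.
Proof.
by move=> c g h; apply/malgP=> k; rewrite mcoeffD !freemod_scaleE mcoeffD mulrDr.
Qed.

Fact freemod_scaleDl g : {morph freemod_scale^~ g : c1 c2 / c1 + c2}.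
Proof.
by move=> c1 c2; apply/malgP=> k; rewrite mcoeffD !freemod_scaleE mulrDl.
Qed.

HB.instance Definition _ := GRing.Zmodule_isLmodule.Build R freemod
  freemod_scaleA freemod_scale1 freemod_scaleDr freemod_scaleDl.

Definition fdelta k : freemod := << (1 : R) *g k >>.

Lemma fcoefZ c g k : (c *: g)@_k = c * g@_k.
Proof. exact: freemod_scaleE. Qed.

Lemma freemodE g : g = \sum_(k <- msupp g) g@_k *: fdelta k.
Proof.
rewrite {1}[g]monalgE; apply/eq_bigr => k _; apply/malgP=> k'.
by rewrite fcoefZ !mcoeffU mulrnAr mulr1.
Qed.

Section Lift.
Variables (V : lmodType R) (f : K -> V).

Definition flift g : V := \sum_(k <- msupp g) g@_k *: f k.

Lemma fliftEw (D : {fset K}) g : fsubset (msupp g) D ->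
  flift g = \sum_(k <- D) g@_k *: f k.
Proof.
move=> sgD; rewrite /flift; apply: big_fset_incl => // k _ kNg.
by rewrite mcoeff_outdom ?scale0r.
Qed.

Fact flift_is_linear : linear flift.
Proof.
move=> c g h.
pose D := fsetU (msupp (c *: g + h)) (fsetU (msupp g) (msupp h)).
have sD : fsubset (msupp (c *: g + h)) D by exact: fsubsetUl.
have sg : fsubset (msupp g) D
  by apply: fsubset_trans (fsubsetUr _ _); exact: fsubsetUl.
have sh : fsubset (msupp h) D
  by apply: fsubset_trans (fsubsetUr _ _); exact: fsubsetUr.
rewrite (fliftEw sD) (fliftEw sg) (fliftEw sh) scaler_sumr -big_split /=.
by apply/eq_bigr => k _; rewrite mcoeffD fcoefZ scalerDl scalerA.
Qed.
HB.instance Definition _ :=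
  GRing.isLinear.Build R freemod V *:%R flift flift_is_linear.

Lemma flift_delta k : flift (fdelta k) = f k.
Proof.
have s : fsubset (msupp (fdelta k)) (fset1 k) by exact: msuppU_le.
by rewrite (fliftEw s) big_seq_fset1 mcoeffUU scale1r.
Qed.

End Lift.

Lemma freemod_ext (V : lmodType R) (f g : {linear freemod -> V}) :
  (forall k, f (fdelta k) = g (fdelta k)) -> f =1 g.
Proof.
move=> fg x; rewrite [x]freemodE !linear_sum.
by apply/eq_bigr => k _; rewrite !linearZ_LR fg.
Qed.

End FreeModule.

Arguments fdelta {R K} k.

(* Exponents of monomials in p variables, and indices of p-fold sequences. *)
Notation midx p := {ffun 'I_p -> nat}.

Definition munit p (i : 'I_p) : midx p := [ffun j => (j == i) : nat].

(* R[T_1,...,T_p]: the free R-module on the monomials, with the product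
   extending bilinearly the product T^m * T^n = T^(m + n) of monomials. *)
Section PolynomialRing.
Variables (R : comPzRingType) (p : nat).

Definition polyring := freemod R (midx p).
HB.instance Definition _ := GRing.Lmodule.on polyring.

Implicit Types (P Q S : polyring) (m n : midx p).

Definition pmon m : polyring := fdelta m.
Definition pmonM m : polyring -> polyring := flift (fun n => pmon (m + n)).
HB.instance Definition _ m := GRing.Linear.on (pmonM m).

Definition polyring_mul P Q : polyring := flift (pmonM^~ Q) P.

Lemma pmonME m n : pmonM m (pmon n) = pmon (m + n).
Proof. exact: flift_delta. Qed.

Lemma polyring_mulE m Q : polyring_mul (pmon m) Q = pmonM m Q.
Proof. exact: flift_delta. Qed.

Fact polyring_mul_linearl Q : linear (polyring_mul^~ Q).
Proof. exact: flift_is_linear. Qed.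

Fact polyring_mul_linearr P : linear (polyring_mul P).
Proof.
move=> c Q S; rewrite /polyring_mul /flift scaler_sumr -big_split /=.
by apply/eq_bigr => m _; rewrite linearP scalerDr !scalerA mulrC.
Qed.

HB.instance Definition _ P := GRing.isLinear.Build R polyring polyring *:%R
  (polyring_mul P) (polyring_mul_linearr P).

Lemma polyring_ext (V : lmodType R) (f g : polyring -> V) :
  linear f -> linear g -> (forall m, f (pmon m) = g (pmon m)) -> f =1 g.
Proof.
move=> lf lg.
pose f' : {linear freemod R (midx p) -> V} :=
  HB.pack f (GRing.isLinear.Build R (freemod R (midx p)) V *:%R f lf).
pose g' : {linear freemod R (midx p) -> V} :=
  HB.pack g (GRing.isLinear.Build R (freemod R (midx p)) V *:%R g lg).
exact: (@freemod_ext _ _ V f' g').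
Qed.

Fact polyring_mulC : commutative polyring_mul.
Proof.
move=> P Q; move: P; apply: polyring_ext.
- exact: polyring_mul_linearl.
- exact: polyring_mul_linearr.
move=> m; move: Q; apply: polyring_ext.
- exact: polyring_mul_linearr.
- exact: polyring_mul_linearl.
by move=> n; rewrite !polyring_mulE !pmonME addrC.
Qed.

Fact polyring_mulA : associative polyring_mul.
Proof.
move=> P Q S; move: P; apply: polyring_ext.
- exact: polyring_mul_linearl.
- by move=> c P P' /=; rewrite !polyring_mul_linearl.
move=> m; move: Q; apply: polyring_ext.
- by move=> c Q Q' /=; rewrite polyring_mul_linearl polyring_mul_linearr.
- by move=> c Q Q' /=; rewrite polyring_mul_linearr polyring_mul_linearl.
move=> n; move: S; apply: polyring_ext.
- by move=> c S S' /=; rewrite !polyring_mul_linearr.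
- exact: polyring_mul_linearr.
by move=> k; rewrite !(polyring_mulE, pmonME) addrA.
Qed.

Fact polyring_mul1 : left_id (pmon 0) polyring_mul.
Proof.
apply: polyring_ext; [exact: polyring_mul_linearr | by [] |].
by move=> m; rewrite polyring_mulE pmonME add0r.
Qed.

Fact polyring_mulDl : left_distributive polyring_mul +%R.
Proof.
by move=> P Q S; have := polyring_mul_linearl S 1 P Q; rewrite !scale1r.
Qed.

HB.instance Definition _ := GRing.Zmodule_isComPzRing.Build polyring
  polyring_mulA polyring_mulC polyring_mul1 polyring_mulDl.

Lemma pmon1E : pmon 0 = 1. Proof. by []. Qed.

Lemma pmonD m n : pmon (m + n) = pmon m * pmon n.
Proof. by rewrite /GRing.mul /= polyring_mulE pmonME. Qed.

Lemma polyring_scalerAl c P Q : c *: (P * Q) = (c *: P) * Q.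
Proof.
have H : (c *: P + 0) * Q = c *: (P * Q) + 0 * Q.
  exact: polyring_mul_linearl.
by rewrite mul0r !addr0 in H.
Qed.

End PolynomialRing.

(* Commuting endomorphisms T_1,...,T_p of an R-module V. *)
Record commops (R : comPzRingType) (p : nat) (V : lmodType R) := CommOps {
  op :> 'I_p -> {linear V -> V};
  opC : forall i j v, op i (op j v) = op j (op i v)
}.

(* V as a module over R[T_1,...,T_p], the variable T_i acting as op T i. *)
Section PolynomialModule.
Variables (R : comPzRingType) (p : nat) (V : lmodType R) (T : commops p V).

Definition monact (m : midx p) (v : V) : V :=
  foldr (fun i => iter (m i) (T i)) v (enum 'I_p).

Lemma iter_opC i j k v : iter k (T i) (T j v) = T j (iter k (T i) v).
Proof. by elim: k => //= k ->; rewrite opC. Qed.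

Lemma iter_iter_opC i j k l v :
  iter k (T i) (iter l (T j) v) = iter l (T j) (iter k (T i) v).
Proof. by elim: l => //= l <-; rewrite iter_opC. Qed.

Lemma iter_op_linear i k : linear (iter k (T i)).
Proof. by move=> c u v; elim: k => //= k ->; rewrite linearP. Qed.

Fact monact_is_linear m : linear (monact m).
Proof.
by rewrite /monact => c u v; elim: (enum _) => //= i s ->; exact: iter_op_linear.
Qed.
HB.instance Definition _ m :=
  GRing.isLinear.Build R V V *:%R (monact m) (monact_is_linear m).

Lemma monact0 v : monact 0 v = v.
Proof. by rewrite /monact; elim: (enum _) => //= i s ->; rewrite ffunE. Qed.

Lemma monactD m n v : monact (m + n) v = monact m (monact n v).
Proof.
rewrite /monact; elim: (enum _) => //= i s IH.
rewrite ffunE IH; rewrite [_ + _]/(addn _ _) iterD; congr (iter _ _ _).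
move: (foldr _ v s) => w; elim: s {IH} => //= j s IH.
by rewrite -IH iter_iter_opC.
Qed.

Lemma monact_unit i v : monact (munit i) v = T i v.
Proof.
have Hs s : uniq s -> i \in s ->
  foldr (fun j => iter (munit i j) (T j)) v s = T i v.
  have Hn s' : i \notin s' ->
    foldr (fun j => iter (munit i j) (T j)) v s' = v.
    elim: s' => //= j s' IH; rewrite inE negb_or => /andP[ij /IH ->].
    by rewrite ffunE eq_sym (negbTE ij).
  elim: s => //= j s IH /andP[js us]; rewrite inE => /orP[/eqP ij|si].
    by rewrite -ij in js *; rewrite Hn // ffunE eqxx.
  rewrite IH // ffunE; case: eqP => // ji.
  by rewrite ji si in js.
by rewrite /monact Hs ?enum_uniq ?mem_enum.
Qed.

(* T is a phantom argument: it selects the action of the polynomials. *)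
Definition polymod of commops p V : Type := V.
Local Notation VT := (polymod T).
HB.instance Definition _ := GRing.Zmodule.on VT.

Definition polyact (P : polyring R p) (v : VT) : VT :=
  flift (fun m => monact m v) P.

Lemma polyact_mon m v : polyact (pmon R m) v = monact m v.
Proof. exact: flift_delta. Qed.

Fact polyact_linearl v : linear (polyact^~ v : _ -> V).
Proof. exact: flift_is_linear. Qed.

Fact polyact_linearr P : linear (polyact P : V -> V).
Proof.
move=> c u v; rewrite /polyact /flift scaler_sumr -big_split /=.
by apply/eq_bigr => m _; rewrite linearP scalerDr !scalerA mulrC.
Qed.

Fact polyactA P Q v : polyact P (polyact Q v) = polyact (P * Q) v.
Proof.
move: P; apply: (@polyring_ext R p V).
- exact: polyact_linearl.
- move=> c P P' /=.
  by rewrite mulrDl -polyring_scalerAl polyact_linearl.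
move=> m; move: Q; apply: (@polyring_ext R p V).
- by move=> c Q Q'; rewrite polyact_linearl polyact_linearr.
- move=> c Q Q' /=.
  by rewrite mulrDr [_ * (c *: Q)]mulrC -polyring_scalerAl polyact_linearl mulrC.
by move=> n; rewrite -pmonD !polyact_mon monactD.
Qed.

Fact polyact1 : left_id 1 polyact.
Proof. by move=> v; rewrite -pmon1E polyact_mon monact0. Qed.

Fact polyactDr : right_distributive polyact +%R.
Proof.
by move=> P u v; have := polyact_linearr P 1 u v; rewrite !scale1r.
Qed.

Fact polyactDl v : {morph polyact^~ v : P Q / P + Q}.
Proof.
by move=> P Q; have := polyact_linearl v 1 P Q; rewrite !scale1r.
Qed.

HB.instance Definition _ := GRing.Zmodule_isLmodule.Build (polyring R p) VT
  polyactA polyact1 polyactDr polyactDl.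

Lemma polymod_scale_mon m (v : VT) : pmon R m *: v = monact m v.
Proof. exact: polyact_mon. Qed.

Lemma polymod_scale_var i (v : VT) : pmon R (munit i) *: v = T i v.
Proof. by rewrite polymod_scale_mon monact_unit. Qed.

Lemma polymod_scale_const c (v : VT) :
  (c *: pmon R (0 : midx p)) *: v = (c *: (v : V) : V).
Proof.
have -> : (c *: pmon R (0 : midx p)) *: v = c *: monact 0 v :> V.
  rewrite -polyact_mon.
  exact: (linearZ_LR (flift (fun m => monact m v)) c (pmon R 0)).
by rewrite monact0.
Qed.

End PolynomialModule.

(* A function of a family (x_i) that is linear in each x_i separately. *)
Definition multilinear (R : pzRingType) (I : eqType) (M : I -> lmodType R)
    (N : lmodType R) (f : (forall i, M i) -> N) : Prop :=
  forall (i : I) (c : R) (u v : M i) (x : forall j, M j),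
    f (dfwith x (c *: u + v)) = c *: f (dfwith x u) + f (dfwith x v).

(* The tensor product of a family of R-modules: the free module on the families
   (x_i), modulo the submodule generated by the multilinearity relations. *)
Section Tensor.
Variables (R : comPzRingType) (I : eqType) (M : I -> lmodType R).

Definition tensor_free := freemod R (forall i, M i).
HB.instance Definition _ := GRing.Lmodule.on tensor_free.

Definition fpure (x : forall i, M i) : tensor_free :=
  fdelta x.

Definition is_tensor_rel (z : tensor_free) : Prop :=
  exists (i : I) (c : R) (u v : M i) (x : forall j, M j),
    z = fpure (dfwith x (c *: u + v))
        - (c *: fpure (dfwith x u) + fpure (dfwith x v)).

Definition tensor_rel : {pred tensor_free} := fun z =>
  `[< forall S : {pred tensor_free}, submod_closed S ->
        (forall r, is_tensor_rel r -> r \in S) -> z \in S >].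

Fact tensor_rel_closed : submod_closed tensor_rel.
Proof.
split; first by apply/asboolP => S [].
move=> c u v /asboolP Hu /asboolP Hv; apply/asboolP => S HS Hr.
by case: (HS) => _; apply; [exact: Hu | exact: Hv].
Qed.
HB.instance Definition _ :=
  GRing.isSubmodClosed.Build R tensor_free tensor_rel tensor_rel_closed.

Definition tensor := Quotient.quot tensor_rel.
HB.instance Definition _ := GRing.Zmodule.on tensor.

Definition tpi (z : tensor_free) : tensor := \pi_(Quotient.quot tensor_rel) z.

Fact tpi_zmod : zmod_morphism tpi.
Proof. by move=> x y; rewrite /tpi raddfB. Qed.
HB.instance Definition _ := GRing.isZmodMorphism.Build tensor_free tensor tpi
  tpi_zmod.

Lemma tpi_eq z1 z2 : (tpi z1 = tpi z2) <-> (z1 - z2 \in tensor_rel).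
Proof. by rewrite Quotient.idealrBE; split => /eqP. Qed.

Lemma tpi_surj t : exists z, t = tpi z.
Proof. by exists (repr t); rewrite /tpi reprK. Qed.

Definition tensor_scale (c : R) (t : tensor) : tensor := tpi (c *: repr t).

Lemma tensor_scaleE c z : tensor_scale c (tpi z) = tpi (c *: z).
Proof.
apply/tpi_eq; rewrite -scalerBr rpredZ //.
by apply/tpi_eq; rewrite /tpi reprK.
Qed.

Fact tensor_scaleA c1 c2 t :
  tensor_scale c1 (tensor_scale c2 t) = tensor_scale (c1 * c2) t.
Proof.
by case: (tpi_surj t) => z ->; rewrite !tensor_scaleE scalerA.
Qed.

Fact tensor_scale1 : left_id 1 tensor_scale.
Proof.
by move=> t; case: (tpi_surj t) => z ->; rewrite !tensor_scaleE scale1r.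
Qed.

Fact tensor_scaleDr : right_distributive tensor_scale +%R.
Proof.
move=> c t1 t2; case: (tpi_surj t1) (tpi_surj t2) => z1 -> [z2 ->].
by rewrite -raddfD !tensor_scaleE scalerDr raddfD.
Qed.

Fact tensor_scaleDl t : {morph tensor_scale^~ t : c1 c2 / c1 + c2}.
Proof.
move=> c1 c2; case: (tpi_surj t) => z ->.
by rewrite !tensor_scaleE scalerDl raddfD.
Qed.

HB.instance Definition _ := GRing.Zmodule_isLmodule.Build R tensor
  tensor_scaleA tensor_scale1 tensor_scaleDr tensor_scaleDl.

Fact tpi_scalable : scalable tpi.
Proof. by move=> c z; rewrite [RHS]tensor_scaleE. Qed.
HB.instance Definition _ :=
  GRing.isScalable.Build R tensor_free tensor *:%R tpi tpi_scalable.

Definition tens (x : forall i, M i) : tensor := tpi (fpure x).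

Lemma tens_multilinear : multilinear tens.
Proof.
move=> i c u v x; rewrite /tens -linearP; apply/tpi_eq.
by apply/asboolP => S _; apply; exists i, c, u, v, x.
Qed.

Lemma tensor_ext (N : lmodType R) (f g : {linear tensor -> N}) :
  (forall x, f (tens x) = g (tens x)) -> f =1 g.
Proof.
move=> fg t; case: (tpi_surj t) => z ->.
exact: (@freemod_ext R _ N (f \o tpi) (g \o tpi)).
Qed.

Section Lift.
Variables (N : lmodType R) (f : (forall i, M i) -> N).

Definition free_lift : tensor_free -> N :=
  flift f.
HB.instance Definition _ := GRing.Linear.on free_lift.

Lemma free_lift_pure x : free_lift (fpure x) = f x.
Proof. exact: flift_delta. Qed.

Variable fP : multilinear f.

Lemma free_lift_rel z : z \in tensor_rel -> free_lift z = 0.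
Proof.
move/asboolP/(_ (fun z => free_lift z == 0)) => H; apply/eqP; apply: H.
  split; first by rewrite unfold_in linear0.
  move=> c u v; rewrite !unfold_in => /eqP Hu /eqP Hv.
  by rewrite linearP /= Hu Hv scaler0 addr0.
move=> _ [i [c [u [v [x ->]]]]]; rewrite unfold_in linearB linearP.
by rewrite /= !free_lift_pure fP subrr.
Qed.

Definition tensor_lift of multilinear f := fun t : tensor => free_lift (repr t).

Lemma tensor_liftE z : tensor_lift fP (tpi z) = free_lift z.
Proof.
apply/eqP; rewrite -subr_eq0 -linearB; apply/eqP/free_lift_rel.
by apply/tpi_eq; rewrite /tpi reprK.
Qed.

Fact tensor_lift_is_linear : linear (tensor_lift fP).
Proof.
move=> c t1 t2; case: (tpi_surj t1) (tpi_surj t2) => z1 -> [z2 ->].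
by rewrite -linearP !tensor_liftE linearP.
Qed.
HB.instance Definition _ := GRing.isLinear.Build R tensor N *:%R
  (tensor_lift fP) tensor_lift_is_linear.

Lemma tensor_lift_tens x : tensor_lift fP (tens x) = f x.
Proof. by rewrite tensor_liftE free_lift_pure. Qed.

End Lift.

(* The endomorphism h applied to the i-th factor. *)
Section Factor.
Variables (i : I) (h : {linear M i -> M i}).

Definition on_factor (x : forall j, M j) : tensor := tens (dfwith x (h (x i))).

Fact on_factor_multilinear : multilinear on_factor.
Proof.
have twice (x : forall j, M j) (u v : M i) :
  dfwith (dfwith x u) v = dfwith x v.
  apply: functional_extensionality_dep => j.
  have [ij|ij] := eqVneq i j; first by case: j / ij; rewrite !dfwith_in.
  by rewrite !dfwith_out.
move=> j c u v x; rewrite /on_factor; have [ij|ij] := eqVneq i j.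
  case: j / ij u v => u v.
  by rewrite !dfwith_in !twice linearP tens_multilinear.
have swap (w : M j) : dfwith (dfwith x w) (h (dfwith x w i)) =
  dfwith (dfwith x (h (x i))) w.
  rewrite dfwith_out 1?eq_sym //; apply: functional_extensionality_dep => k.
  have [ik|ik] := eqVneq i k.
    by case: k / ik; rewrite dfwith_in dfwith_out ?dfwith_in // eq_sym.
  have [jk|jk] := eqVneq j k; last by rewrite !dfwith_out.
  by case: k / jk ik => ik; rewrite dfwith_out // !dfwith_in.
by rewrite !swap tens_multilinear.
Qed.

Definition tensor_factor : {linear tensor -> tensor} :=
  tensor_lift on_factor_multilinear.

Lemma tensor_factorE x : tensor_factor (tens x) = tens (dfwith x (h (x i))).
Proof. exact: tensor_lift_tens. Qed.

End Factor.

End Tensor.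

Section FactorOps.
Variables (R : comPzRingType) (p : nat) (M : 'I_p -> lmodType R).
Variable (h : forall i, {linear M i -> M i}).

Fact tensor_factorC i j t :
  tensor_factor (h i) (tensor_factor (h j) t) =
  tensor_factor (h j) (tensor_factor (h i) t).
Proof.
have [ij|ij] := eqVneq i j; first by case: j / ij.
apply: (@tensor_ext _ _ _ _
  (tensor_factor (h i) \o tensor_factor (h j))
  (tensor_factor (h j) \o tensor_factor (h i))) => x /=.
rewrite !tensor_factorE; congr tens.
apply: functional_extensionality_dep => k.
have [ik|ik] := eqVneq i k.
  case: k / ik; rewrite dfwith_in dfwith_out 1?eq_sym //.
  by rewrite dfwith_out 1?eq_sym // dfwith_in.
rewrite dfwith_out //; have [jk|jk] := eqVneq j k.
  by case: k / jk ik => ik; rewrite !dfwith_in dfwith_out.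
by rewrite !dfwith_out.
Qed.

Definition tensor_ops : commops p (tensor M) :=
  CommOps (op := fun i => tensor_factor (h i)) tensor_factorC.

End FactorOps.

(* F_M(a): the entry a 0 j, with j counted from 0, is the coefficient a_(j+1). *)
Section LinearRecurrence.
Variables (R : comPzRingType) (M : lmodType R) (d : nat) (a : 'rV[R]_d).

Definition is_linrec : {pred nat -> M} := fun x =>
  `[< forall n, x (n + d)%N = \sum_(j < d) a 0 j *: x (n + d - j.+1)%N >].

Fact is_linrec_closed : submod_closed is_linrec.
Proof.
split=> [|c x y /asboolP Hx /asboolP Hy]; apply/asboolP => n.
  by rewrite big1 // => j _; rewrite scaler0.
have cxyE k : (c *: x + y) k = c *: x k + y k by [].
rewrite cxyE Hx Hy scaler_sumr -big_split /=.
by apply: eq_bigr => j _; rewrite cxyE scalerDr !scalerA mulrC.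
Qed.
HB.instance Definition _ :=
  GRing.isSubmodClosed.Build R (nat -> M) is_linrec is_linrec_closed.

Record linrec := LinRec { linrec_val :> nat -> M; _ : linrec_val \in is_linrec }.
HB.instance Definition _ := [isSub for linrec_val].
HB.instance Definition _ := [Choice of linrec by <:].
HB.instance Definition _ := [SubChoice_isSubLmodule of linrec by <:].

Lemma linrecP (x : linrec) n :
  x (n + d)%N = \sum_(j < d) a 0 j *: x (n + d - j.+1)%N.
Proof. by move: n; apply/asboolP; case: x. Qed.

Fact shift_is_linrec (x : linrec) : (fun n => x n.+1) \in is_linrec.
Proof.
apply/asboolP => n; rewrite -addSn linrecP; apply: eq_bigr => j _.
by rewrite addSn subSn // -[j.+1]add0n leq_add.
Qed.

Definition linrec_shift_fun (x : linrec) : linrec := LinRec (shift_is_linrec x).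

Fact linrec_shift_is_linear : linear linrec_shift_fun.
Proof. by move=> c x y; apply: val_inj. Qed.
HB.instance Definition _ := GRing.isLinear.Build R linrec linrec *:%R
  linrec_shift_fun linrec_shift_is_linear.

Definition linrec_shift : {linear linrec -> linrec} := linrec_shift_fun.

End LinearRecurrence.

(* F^[p]_L(a^(1),...,a^(p)): munit i *+ k is the index with k in position i and
   0 elsewhere. *)
Section MultipleRecurrence.
Variables (R : comPzRingType) (L : lmodType R) (p : nat).
Variables (d : 'I_p -> nat) (a : forall i, 'rV[R]_(d i)).

Definition is_mlinrec : {pred midx p -> L} := fun x =>
  `[< forall (i : 'I_p) (n : midx p),
        x (n + munit i *+ d i) =
        \sum_(j < d i) a i 0 j *: x (n + munit i *+ (d i - j.+1)) >].

Fact is_mlinrec_closed : submod_closed is_mlinrec.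
Proof.
split=> [|c x y /asboolP Hx /asboolP Hy]; apply/asboolP => i n.
  by rewrite big1 // => j _; rewrite scaler0.
have cxyE k : (c *: x + y) k = c *: x k + y k by [].
rewrite cxyE Hx Hy scaler_sumr -big_split /=.
by apply: eq_bigr => j _; rewrite cxyE scalerDr !scalerA mulrC.
Qed.
HB.instance Definition _ :=
  GRing.isSubmodClosed.Build R (midx p -> L) is_mlinrec is_mlinrec_closed.

Record mlinrec :=
  MLinRec { mlinrec_val :> midx p -> L; _ : mlinrec_val \in is_mlinrec }.
HB.instance Definition _ := [isSub for mlinrec_val].
HB.instance Definition _ := [Choice of mlinrec by <:].
HB.instance Definition _ := [SubChoice_isSubLmodule of mlinrec by <:].

Lemma mlinrecP (x : mlinrec) (i : 'I_p) (n : midx p) :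
  x (n + munit i *+ d i) =
  \sum_(j < d i) a i 0 j *: x (n + munit i *+ (d i - j.+1)).
Proof. by move: i n; apply/asboolP; case: x. Qed.

Fact shift_is_mlinrec i (x : mlinrec) : (fun n => x (n + munit i)) \in is_mlinrec.
Proof.
apply/asboolP => k n; rewrite addrAC mlinrecP; apply: eq_bigr => j _.
by rewrite addrAC.
Qed.

Definition mlinrec_shift_fun i (x : mlinrec) : mlinrec :=
  MLinRec (shift_is_mlinrec i x).

Fact mlinrec_shift_is_linear i : linear (mlinrec_shift_fun i).
Proof. by move=> c x y; apply: val_inj. Qed.
HB.instance Definition _ i := GRing.isLinear.Build R mlinrec mlinrec *:%R
  (mlinrec_shift_fun i) (mlinrec_shift_is_linear i).

Fact mlinrec_shiftC i j x :
  mlinrec_shift_fun i (mlinrec_shift_fun j x) =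
  mlinrec_shift_fun j (mlinrec_shift_fun i x).
Proof.
by apply: val_inj; apply: functional_extensionality_dep => n /=; rewrite addrAC.
Qed.

Definition mlinrec_ops : commops p mlinrec :=
  CommOps (op := fun i => mlinrec_shift_fun i) mlinrec_shiftC.

End MultipleRecurrence.

Definition free_of_rank (R : pzRingType) (V : lmodType R) (n : nat) : Prop :=
  exists e : 'I_n -> V,
    forall v : V, exists! c : 'rV[R]_n, v = \sum_(i < n) c 0 i *: e i.

(* Main.v *)
(* Let [e_k], [k < d], be the solutions in [R] of a recurrence of order [d] with
   initial values [e_k(j) = delta_(jk)] for [j < d].  Every solution [x] with
   values in [M] is [sum_k e_k x_k], and every multiple solution [y] is
   [y_n = sum_k (prod_i e^(i)_(k_i)(n_i)) y_k], the sum being over the box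
   [k_i < d_i].  Hence the map sending [x_1 (x) ... (x) x_p] to
   [n |-> x_1(n_1) (x) ... (x) x_p(n_p)] has inverse [y |-> sum_k G_k(y_k)],
   where [G_k] sends [m_1 (x) ... (x) m_p] to
   [e^(1)_(k_1) m_1 (x) ... (x) e^(p)_(k_p) m_p]; and the products
   [prod_i e^(i)_(k_i)] form a basis of the multiple solutions in [R]. *)

Require Import Defs.
From HB Require Import structures.
From mathcomp Require Import all_boot all_algebra.
From mathcomp Require Import boolp.

Set Implicit Arguments.
Unset Strict Implicit.
Unset Printing Implicit Defensive.

Import GRing.Theory.
Local Open Scope ring_scope.

(** * Families of elements with one coordinate replaced *)

Section DfwithTheory.
Variables (I : eqType) (T : I -> Type).

Lemma dfwithE (x y : forall i, T i) (i : I) :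
  (forall j, i != j -> x j = y j) -> y = dfwith x (y i).
Proof.
move=> xy; apply: functional_extensionality_dep => j.
have [ij|ij] := eqVneq i j; first by case: j / ij; rewrite dfwith_in.
by rewrite dfwith_out // xy.
Qed.

Lemma dfwith_id (x : forall i, T i) (i : I) : dfwith x (x i) = x.
Proof. by rewrite -(@dfwithE x x i). Qed.

End DfwithTheory.

Lemma dfwith_map (I : eqType) (T U : I -> Type) (h : forall i, T i -> U i)
    (x : forall i, T i) (i : I) (u : T i) :
  (fun j => h j (dfwith x u j)) = dfwith (fun j => h j (x j)) (h i u).
Proof.
rewrite -[u in RHS](dfwith_in x).
apply: (dfwithE (y := fun j => h j (dfwith x u j))) => j ij.
by rewrite dfwith_out.
Qed.

(** * Multilinear maps applied to scalar multiples and to finite sums *)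

Section MultilinearTheory.
Variables (R : comPzRingType) (I : finType) (M : I -> lmodType R).
Variables (N : lmodType R) (f : (forall i, M i) -> N).
Hypothesis fP : multilinear f.

Lemma multilinear_coord_sum (x : forall i, M i) (i : I) (J : Type)
    (s : seq J) (P : pred J) (c : J -> R) (u : J -> M i) :
  f (dfwith x (\sum_(j <- s | P j) c j *: u j)) =
  \sum_(j <- s | P j) c j *: f (dfwith x (u j)).
Proof.
pose g (w : M i) := f (dfwith x w).
have g_lin : linear g by move=> b v w; exact: fP.
pose g' : {linear M i -> N} :=
  HB.pack g (GRing.isLinear.Build R (M i) N *:%R g g_lin).
rewrite -[LHS]/(g' _) linear_sum; apply: eq_bigr => j _.
by rewrite linearZ_LR.
Qed.

Lemma multilinear_scale (c : I -> R) (u : forall i, M i) :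
  f (fun i => c i *: u i) = (\prod_i c i) *: f u.
Proof.
(* [w s] carries the scalars only at the indices in [s], so each step of the induction extracts one
   scalar. *)
pose w (s : seq I) i := (if i \in s then c i else 1) *: u i.
have step s : uniq s -> f (w s) = (\prod_(i <- s) c i) *: f u.
  elim: s => [_|i s IH /= /andP[si us]].
    rewrite big_nil scale1r; congr f.
    by apply: functional_extensionality_dep => i; rewrite /w scale1r.
  (* The one-term sum puts the scalar multiple in the form that [multilinear_coord_sum] handles. *)
  have -> : w (i :: s) = dfwith (w s) (\sum_(j <- [:: i]) c j *: u i).
    rewrite big_seq1; have -> : c i *: u i = w (i :: s) i.
      by rewrite /w mem_head.
    by apply: dfwithE => j ij; rewrite /w inE eq_sym (negbTE ij).
  rewrite multilinear_coord_sum big_seq1 big_cons -scalerA -IH //.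
  have {1}-> : u i = w s i by rewrite /w (negbTE si) scale1r.
  by rewrite dfwith_id.
rewrite -[in RHS]big_enum -step ?enum_uniq //; congr f.
by apply: functional_extensionality_dep => i; rewrite /w mem_enum.
Qed.

(* Induction on a list [s] containing every [i] for which [Q i] is not a
   singleton. *)
Lemma multilinear_sum_cond (T : I -> finType) (Q : forall i, pred (T i))
    (u : forall i, T i -> M i) :
  f (fun i => \sum_(t | Q i t) u i t) =
  \sum_(k : {dffun forall i, T i} | [forall i, Q i (k i)])
    f (fun i => u i (k i)).
Proof.
have : forall i, i \notin enum I -> exists t, Q i =1 pred1 t.
  by move=> i; rewrite mem_enum.
elim: (enum I) Q => [|i s IH] Q Qs.
  (* All the [Q i] are singletons here, so both sides reduce to the term at the single choice
     [k]. *)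
  pose k i := sval (cid (Qs i isT)).
  have Qk i : Q i =1 pred1 (k i) by exact: (svalP (cid (Qs i isT))).
  pose k' : {dffun forall i, T i} := [ffun i => k i].
  rewrite (big_pred1 k') => [|l /=].
    congr f; apply: functional_extensionality_dep => i.
    by rewrite (big_pred1 (k i)) ?ffunE.
  apply/forallP/eqP => [Ql|-> i]; last by rewrite ffunE Qk /=.
  by apply/ffunP => i; rewrite ffunE; apply/eqP; have := Ql i; rewrite Qk.
pose w j := \sum_(t | Q j t) u j t.
have -> : f w = \sum_(t | Q i t) f (dfwith w (u i t)).
  transitivity (\sum_(t | Q i t) 1 *: f (dfwith w (u i t))).
    rewrite -multilinear_coord_sum; congr f; rewrite -[LHS](dfwith_id _ i).
    by congr (dfwith _ _); apply: eq_bigr => t _; rewrite scale1r.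
  by apply: eq_bigr => t _; rewrite scale1r.
(* Group the choice functions by their value [t] at [i]. Fixing it replaces [Q i] by the singleton
   [pred1 t], so that [s] suffices as the list for [Qt']. *)
rewrite [RHS](partition_big (fun k : {dffun forall i, T i} => k i) (Q i)) /=;
  last by move=> k /forallP.
apply: eq_bigr => t Qt; pose Qt' := dfwith Q (pred1 t).
have -> : dfwith w (u i t) = fun j => \sum_(t' | Qt' j t') u j t'.
  have -> : u i t = \sum_(t' | Qt' i t') u i t'.
    by rewrite /Qt' dfwith_in big_pred1_eq.
  apply/esym/(dfwithE (y := fun j => \sum_(t' | Qt' j t') u j t')) => j ij.
  by rewrite /Qt' dfwith_out.
rewrite IH => [|j js].
  apply: eq_bigl => k; apply/forallP/andP => [H|[/forallP H /eqP kt] j].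
    split; last by have := H i; rewrite /Qt' dfwith_in.
    apply/forallP => j; have := H j; rewrite /Qt'.
    have [ij|ij] := eqVneq i j; last by rewrite dfwith_out.
    by case: j / ij; rewrite dfwith_in /= => /eqP ->.
  rewrite /Qt'; have [ij|ij] := eqVneq i j; last by rewrite dfwith_out.
  by case: j / ij; rewrite dfwith_in /= kt.
rewrite /Qt'; have [ij|ij] := eqVneq i j.
  by case: j / ij js => _; exists t; rewrite dfwith_in.
rewrite dfwith_out //; apply: Qs.
by rewrite inE eq_sym negb_or ij.
Qed.

Lemma multilinear_sum (T : I -> finType) (u : forall i, T i -> M i) :
  f (fun i => \sum_t u i t) =
  \sum_(k : {dffun forall i, T i}) f (fun i => u i (k i)).
Proof.
rewrite (multilinear_sum_cond (fun=> predT)); apply: eq_bigl => k.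
exact/forallP.
Qed.

End MultilinearTheory.

(** * Induction on tensors, and the tensor product of linear maps *)

Lemma tensor_ind (R : comPzRingType) (I : eqType) (M : I -> lmodType R)
    (P : tensor M -> Prop) :
  P 0 -> (forall c t1 t2, P t1 -> P t2 -> P (c *: t1 + t2)) ->
  (forall x, P (tens x)) -> forall t, P t.
Proof.
move=> P0 PD Pt t; case: (tpi_surj t) => z ->.
rewrite [z](@freemodE R) linear_sum; apply: big_rec => // x t' _ Pt'.
rewrite linearZ_LR; apply: PD => //; exact: Pt.
Qed.

Section TensorMap.
Variables (R : comPzRingType) (I : eqType) (M N : I -> lmodType R).
Variable h : forall i, {linear M i -> N i}.

Fact tens_map_multilinear :
  multilinear (fun x : forall i, M i => tens (fun i => h i (x i))).
Proof.
move=> i c u v x; rewrite !(dfwith_map (fun j => h j)) linearP.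
exact: tens_multilinear.
Qed.

Definition tensor_map : {linear tensor M -> tensor N} :=
  tensor_lift tens_map_multilinear.

Lemma tensor_map_tens x : tensor_map (tens x) = tens (fun i => h i (x i)).
Proof. exact: tensor_lift_tens. Qed.

End TensorMap.

(** * Linearity over the polynomial ring *)

Section PolymodLinear.
Variables (R : comPzRingType) (p : nat) (V W : lmodType R).
Variables (S : commops p V) (T : commops p W) (f : {linear V -> W}).
Hypothesis fST : forall i v, f (S i v) = T i (f v).

Lemma monact_intertwine m v : f (monact S m v) = monact T m (f v).
Proof.
rewrite /monact; elim: (enum _) => //= i s <-.
by elim: (m i) => //= k <-.
Qed.

(** A polynomial acts as an [R]-combination of monomials in the operators, so an [R]-linear map that
    intertwines the operators commutes with every polynomial. *)
Lemma polymod_linear : linear (f : polymod S -> polymod T).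
Proof.
move=> P u v; rewrite -[P *: u + v]/((P *: u : V) + v) raddfD; congr (_ + _).
rewrite -[LHS]/(f (\sum_(m <- _) _)) linear_sum; apply: eq_bigr => m _.
by rewrite linearZ_LR /= monact_intertwine.
Qed.

End PolymodLinear.

(** * Fundamental solutions of a single recurrence *)

Section FundamentalSolutions.
Variables (R : comPzRingType) (d : nat) (a : 'rV[R]_d).

(* Only the entries [w j] with [j < d] matter: the window
   [(x_n, ..., x_(n+d-1))] is sent to [(x_(n+1), ..., x_(n+d))]. *)
Definition linrec_step (w : nat -> R) (j : nat) : R :=
  if (j.+1 < d)%N then w j.+1 else \sum_(l < d) a 0 l * w (d - l.+1)%N.

(** For [k < d] this is the solution e_k. Iterating on whole windows keeps the recursion structural,
    although each term depends on the [d] preceding ones. *)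
Definition fund (k n : nat) : R :=
  iter n linrec_step (fun j => (j == k)%:R) 0%N.

Lemma fund_window k n j : (j < d)%N ->
  iter n linrec_step (fun j => (j == k)%:R) j = fund k (n + j).
Proof.
elim: j n => [|j IH] n jd; first by rewrite addn0.
by rewrite addnS -addSn -IH ?(ltnW jd) //= /linrec_step jd.
Qed.

Lemma fund_init k j : (j < d)%N -> fund k j = (j == k)%:R.
Proof. by move=> jd; rewrite -[j in LHS]add0n -fund_window. Qed.

Lemma fund_rec k n : (0 < d)%N ->
  fund k (n + d) = \sum_(l < d) a 0 l * fund k (n + (d - l.+1)).
Proof.
(* The entry of index [n + d] is the last one, at [d.-1], of window [n.+1]: exactly the entry that
   [linrec_step] computes from the recurrence. *)
move=> d0; rewrite -[d in LHS](prednK d0) addnS -addSn -fund_window ?prednK //=.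
rewrite /linrec_step prednK // ltnn; apply: eq_bigr => l _.
by rewrite -fund_window // ltn_subrL d0.
Qed.

Variable M : lmodType R.

Lemma linrec_inj (x y : linrec M a) :
  (forall j, (j < d)%N -> x j = y j) -> x = y.
Proof.
move=> xy; apply/val_inj/functional_extensionality_dep.
elim/ltn_ind => n IH /=; have [|dn] := ltnP n d; first exact: xy.
rewrite -(subnK dn) !linrecP; apply: eq_bigr => j _; congr (_ *: _).
apply: IH; rewrite subnK // ltn_subrL //.
by apply: leq_trans dn; apply: leq_ltn_trans (ltn_ord j).
Qed.

Definition linrec_eval (n : nat) (x : linrec M a) : M := x n.

Fact linrec_eval_is_linear n : linear (linrec_eval n).
Proof. by []. Qed.
HB.instance Definition _ n := GRing.isLinear.Build R (linrec M a) M *:%R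
  (linrec_eval n) (linrec_eval_is_linear n).

Fact fundM_is_linrec (k : 'I_d) (m : M) :
  (fun n => fund k n *: m) \in @is_linrec R M d a.
Proof.
have d0 : (0 < d)%N by apply: leq_ltn_trans (ltn_ord k).
apply/asboolP => n; rewrite fund_rec // scaler_suml.
by apply: eq_bigr => l _; rewrite scalerA addnBA.
Qed.

Definition fundM (k : 'I_d) (m : M) : linrec M a :=
  LinRec (fundM_is_linrec k m).

Fact fundM_is_linear k : linear (fundM k).
Proof.
move=> c u v; apply/val_inj/functional_extensionality_dep => n.
rewrite -[RHS]/(c *: (fund k n *: u) + fund k n *: v).
by rewrite /= scalerDr !scalerA mulrC.
Qed.
HB.instance Definition _ k := GRing.isLinear.Build R M (linrec M a) *:%R
  (fundM k) (fundM_is_linear k).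

(** Both sides are solutions, so it suffices to compare their first [d] entries, where the
    fundamental solutions are Kronecker deltas. *)
Lemma linrec_expand (x : linrec M a) : \sum_(k < d) fundM k (x k) = x.
Proof.
apply: linrec_inj => j jd.
rewrite -[LHS]/(linrec_eval j _) linear_sum (bigD1 (Ordinal jd)) //=.
rewrite /linrec_eval /= fund_init // eqxx scale1r big1 ?addr0 // => k kj.
rewrite fund_init // -[j]/(val (Ordinal jd)) eq_sym val_eqE (negbTE kj).
exact: scale0r.
Qed.

End FundamentalSolutions.

Lemma munitDE p (n : midx p) (i j : 'I_p) m :
  (n + munit i *+ m) j = (n j + (j == i) * m)%N.
Proof.
rewrite ffunE; congr addn; elim: m => [|m IH]; first by rewrite ffunE muln0.
by rewrite mulrS ffunE IH ffunE mulnS.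
Qed.

(** * Products of fundamental solutions as multiple solutions *)

Section MultipleFundamentalSolutions.
Variables (R : comPzRingType) (p : nat) (d : 'I_p -> nat).
Variable a : forall i, 'rV[R]_(d i).

Notation box := {dffun forall i : 'I_p, 'I_(d i)}.

Definition box_idx (k : box) : midx p := [ffun i => nat_of_ord (k i)].

Definition mfund (k : box) (n : midx p) : R := \prod_i fund (a i) (k i) (n i).

Lemma mfund_box k l : mfund k (box_idx l) = (l == k)%:R.
Proof.
rewrite /mfund; have [->|/eqP lk] := eqVneq l k.
  by rewrite big1 // => i _; rewrite ffunE fund_init // eqxx.
have /existsP[i li] : [exists i, l i != k i].
  apply: contra_notT lk => /existsPn H; apply/ffunP => i; apply/eqP.
  by have := H i; rewrite negbK.
by rewrite (bigD1 i) //= ffunE fund_init // val_eqE (negbTE li) mul0r.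
Qed.

Variable L : lmodType R.

Lemma mfund_comb_is_mlinrec (c : box -> L) :
  (fun n => \sum_k mfund k n *: c k) \in @is_mlinrec R L p d a.
Proof.
apply/asboolP => i n.
under [RHS]eq_bigr do rewrite scaler_sumr.
rewrite exchange_big /=; apply: eq_bigr => k _.
have d0 : (0 < d i)%N by apply: leq_ltn_trans (ltn_ord (k i)).
(* Moving in direction [i] changes only the [i]-th factor of the product, so the recurrence of that
   factor passes to the product. *)
have E m : mfund k (n + munit i *+ m) =
    fund (a i) (k i) (n i + m) * \prod_(j | j != i) fund (a j) (k j) (n j).
  rewrite /mfund (bigD1 i) //= munitDE eqxx mul1n; congr (_ * _).
  by apply: eq_bigr => j /negbTE ji; rewrite munitDE ji mul0n addn0.
rewrite E fund_rec // mulr_suml scaler_suml.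
by apply: eq_bigr => l _; rewrite E scalerA mulrA.
Qed.

Definition mfund_comb (c : box -> L) : mlinrec L a :=
  MLinRec (mfund_comb_is_mlinrec c).

(** Induction on the sum of the indices: outside the box some [n i] is at least [d i], and the
    recurrence in direction [i] leads to smaller sums. *)
Lemma mlinrec_inj (x y : mlinrec L a) :
  (forall k : box, x (box_idx k) = y (box_idx k)) -> x = y.
Proof.
move=> xy; apply/val_inj/functional_extensionality_dep => n /=.
have [m] := ubnP (\sum_i n i); elim: m n => // m IH n nm.
have [/existsP[i dn]|/existsPn nd] := boolP [exists i, (d i <= n i)%N].
  (* The truncated subtraction is exact, since [d i <= n i]. *)
  pose n' : midx p := [ffun j => (n j - (j == i) * d i)%N].
  have -> : n = n' + munit i *+ d i.
    apply/ffunP => j; rewrite munitDE ffunE subnK //.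
    by case: eqP => // ->; rewrite mul1n.
  rewrite !mlinrecP; apply: eq_bigr => j _; congr (_ *: _).
  apply: IH; rewrite -ltnS; apply: leq_trans nm; rewrite ltnS.
  (* Coordinate [i] drops from [n i] to [n i - j.+1], and the others are unchanged. *)
  rewrite (bigD1 i) //= [X in (_ < X)%N](bigD1 i) //= -addSn.
  apply: leq_add.
    rewrite munitDE ffunE eqxx !mul1n -ltn_subRL.
    rewrite subKn // ltn_subrL //.
    exact: leq_ltn_trans (ltn_ord j).
  by apply: leq_sum => l /negbTE li; rewrite munitDE ffunE li mul0n subn0 addn0.
have nlt i : (n i < d i)%N by rewrite ltnNge; exact: nd.
pose k : box := [ffun i => Ordinal (nlt i)].
suff -> : n = box_idx k by exact: xy.
by apply/ffunP => i; rewrite !ffunE.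
Qed.

Lemma mlinrec_expand (x : mlinrec L a) n :
  x n = \sum_k mfund k n *: x (box_idx k).
Proof.
suff {1}-> : x = mfund_comb (fun k => x (box_idx k)) by [].
apply: mlinrec_inj => l /=; apply/esym.
rewrite (bigD1 l) //= mfund_box eqxx scale1r.
rewrite big1 ?addr0 // => k kl.
by rewrite mfund_box eq_sym (negbTE kl) scale0r.
Qed.

Definition mlinrec_eval (n : midx p) (x : mlinrec L a) : L := x n.

Fact mlinrec_eval_is_linear n : linear (mlinrec_eval n).
Proof. by []. Qed.
HB.instance Definition _ n := GRing.isLinear.Build R (mlinrec L a) L *:%R
  (mlinrec_eval n) (mlinrec_eval_is_linear n).

End MultipleFundamentalSolutions.

(** * Freeness of the module of multiple solutions in [R] *)

Lemma free_of_rank_basis (R : pzRingType) (V : lmodType R) (K : finType)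
    (e : K -> V) (coord : V -> K -> R) :
  (forall v, v = \sum_k coord v k *: e k) ->
  (forall c : K -> R, coord (\sum_k c k *: e k) =1 c) ->
  free_of_rank V #|K|.
Proof.
move=> ve ce; exists (e \o enum_val) => v.
have sumE (c : K -> R) :
    \sum_(i < #|K|) c (enum_val i) *: e (enum_val i) = \sum_k c k *: e k.
  rewrite [RHS](reindex (@enum_val K K)) //.
  by apply: onW_bij; exact: enum_val_bij.
exists (\row_i coord v (enum_val i)); split.
  rewrite [LHS]ve -sumE; apply: eq_bigr => i _ /=.
  by rewrite mxE.
move=> c /= vc; apply/rowP => i; rewrite mxE.
have {}vc : v = \sum_k c 0 (enum_rank k) *: e k.
  by rewrite vc -sumE; apply: eq_bigr => j _; rewrite enum_valK.
by rewrite vc ce enum_valK.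
Qed.

Lemma mlinrec_free (R : comPzRingType) (p : nat) (d : 'I_p -> nat)
    (a : forall i, 'rV[R]_(d i)) :
  free_of_rank (mlinrec R^o a) (\prod_(i < p) d i)%N.
Proof.
pose K := {dffun forall i : 'I_p, 'I_(d i)}.
have -> : (\prod_(i < p) d i)%N = #|K|.
  rewrite card_dep_ffun foldrE big_map big_enum.
  by apply: eq_bigr => i _; rewrite card_ord.
(* [e k] is [mfund a k], written as a combination with delta coefficients so that it is a solution
   by construction. Its coordinate functions are the values on the box. *)
pose e (k : K) : mlinrec R^o a := mfund_comb a (fun l => (l == k)%:R : R^o).
have eE c k n : mlinrec_eval n (c *: e k) = c * mfund a k n.
  rewrite -[LHS]/(c * \sum_l mfund a l n * (l == k)%:R).
  rewrite (bigD1 k) //= eqxx mulr1 big1 ?addr0 // => l /negbTE ->.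
  exact: mulr0.
apply: (@free_of_rank_basis _ _ _ e
  (fun v k => mlinrec_eval (box_idx k) v)) => [v|c k].
  apply/val_inj/functional_extensionality_dep => n.
  rewrite -[RHS]/(mlinrec_eval n _) linear_sum [LHS]mlinrec_expand.
  by apply: eq_bigr => k _; rewrite [RHS]eE; exact: mulrC.
rewrite linear_sum (bigD1 k) //= [X in X + _]eE mfund_box eqxx mulr1.
rewrite big1 ?addr0 // => l lk; rewrite [LHS]eE mfund_box eq_sym (negbTE lk).
exact: mulr0.
Qed.

(** * The isomorphism and its inverse *)

Section TensorOfRecurrences.
Variables (R : comPzRingType) (p : nat) (d : 'I_p -> nat).
Variables (a : forall i, 'rV[R]_(d i)) (M : 'I_p -> lmodType R).

Notation F := (tensor (fun i => linrec (M i) (a i))).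

Definition tensor_eval (n : midx p) : {linear F -> tensor M} :=
  tensor_map (fun i => linrec_eval (a:=a i) (M:=M i) (n i)).

Fact tensor_eval_is_mlinrec (t : F) :
  (fun n => tensor_eval n t) \in @is_mlinrec R (tensor M) p d a.
Proof.
apply/asboolP => i n; elim/tensor_ind: t => [|c t1 t2 H1 H2|x].
- by rewrite linear0 big1 // => j _; rewrite linear0 scaler0.
- rewrite linearP H1 H2 scaler_sumr -big_split /=; apply: eq_bigr => j _.
  by rewrite linearP scalerDr !scalerA mulrC.
(* On a pure tensor a move in direction [i] affects only the [i]-th component, so the recurrence of
   [x i] can be expanded in that slot. *)
have E m : tensor_eval (n + munit i *+ m) (tens x) =
    tens (dfwith (fun j => x j (n j)) (x i (n i + m)%N)).
  rewrite /tensor_eval tensor_map_tens; congr tens.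
  have -> : x i (n i + m)%N = linrec_eval ((n + munit i *+ m)%R i) (x i).
    by rewrite munitDE eqxx mul1n.
  apply: (dfwithE (y := fun j => linrec_eval ((n + munit i *+ m)%R j) (x j))).
  by move=> j /negbTE ij; rewrite munitDE eq_sym ij addn0.
rewrite E linrecP (multilinear_coord_sum (@tens_multilinear R _ M)).
by apply: eq_bigr => j _; rewrite E addnBA.
Qed.

Definition to_mlinrec (t : F) : mlinrec (tensor M) a :=
  MLinRec (tensor_eval_is_mlinrec t).

Fact to_mlinrec_is_linear : linear to_mlinrec.
Proof.
move=> c t1 t2; apply/val_inj/functional_extensionality_dep => n /=.
by rewrite linearP.
Qed.
HB.instance Definition _ := GRing.isLinear.Build R F (mlinrec (tensor M) a) *:%R
  to_mlinrec to_mlinrec_is_linear.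

Lemma to_mlinrec_shift i (t : F) :
  to_mlinrec (tensor_ops (fun i => linrec_shift (M i) (a i)) i t) =
  mlinrec_ops (tensor M) a i (to_mlinrec t).
Proof.
apply/val_inj/functional_extensionality_dep => n.
rewrite -[LHS]/(tensor_eval n
  (@tensor_factor R _ (fun i => linrec (M i) (a i)) i (linrec_shift _ _) t)).
rewrite -[RHS]/(tensor_eval (n + munit i) t).
elim/tensor_ind: t => [|c t1 t2 H1 H2|x]; first by rewrite !linear0.
  by rewrite !linearP H1 H2.
rewrite /tensor_eval tensor_factorE !tensor_map_tens; congr tens.
apply: functional_extensionality_dep => j; rewrite -[munit i]mulr1n munitDE.
rewrite /linrec_eval muln1; have [ij|ij] := eqVneq i j.
  by case: j / ij; rewrite dfwith_in addn1.
by rewrite dfwith_out // addn0.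
Qed.

Definition of_mlinrec (y : mlinrec (tensor M) a) : F :=
  \sum_(k : {dffun forall i, 'I_(d i)})
     tensor_map (fun i => fundM (a i) (M:=M i) (k i)) (y (box_idx k)).

Lemma to_mlinrecK : cancel to_mlinrec of_mlinrec.
Proof.
move=> t; elim/tensor_ind: t => [|c t1 t2 H1 H2|x].
- rewrite linear0 /of_mlinrec big1 // => k _; exact: linear0.
- rewrite -[in RHS]H1 -[in RHS]H2 /of_mlinrec scaler_sumr -big_split /=.
  by apply: eq_bigr => k _; rewrite !linearP.
rewrite /of_mlinrec /=.
(* Multilinearity turns the tensor of the expansions of the [x i] into a sum over the box. *)
transitivity (tens (fun i => \sum_(k < d i) fundM (a i) k (x i k))).
  rewrite (multilinear_sum (@tens_multilinear R _ _)
    (fun i k => fundM (a i) k (x i k))).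
  apply: eq_bigr => k _; rewrite !tensor_map_tens; congr tens.
  apply: functional_extensionality_dep => i.
  by rewrite /linrec_eval ffunE.
congr tens; apply: functional_extensionality_dep => i; exact: linrec_expand.
Qed.

Lemma of_mlinrecK : cancel of_mlinrec to_mlinrec.
Proof.
move=> y; apply/val_inj/functional_extensionality_dep => n.
rewrite [RHS]mlinrec_expand -[LHS]/(tensor_eval n _) linear_sum.
(* The claim for each [k] holds for an arbitrary tensor in place of the value of [y], which allows a
   reduction to pure tensors. *)
apply: eq_bigr => k _; move: (y _) => t.
elim/tensor_ind: t => [|c t1 t2 H1 H2|x].
- by rewrite !linear0.
- by rewrite !linearP H1 H2.
rewrite /tensor_eval !tensor_map_tens.
by rewrite -(multilinear_scale (@tens_multilinear R _ M)).
Qed.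

End TensorOfRecurrences.

Theorem proposition3p6 (R : comPzRingType) (p : nat) (hp : (0 < p)%N)
    (d : 'I_p -> nat) (hd : forall i, (0 < d i)%N)
    (a : forall i, 'rV[R]_(d i)) (M : 'I_p -> lmodType R) :
  (exists f : {linear
       polymod (tensor_ops (fun i => linrec_shift (M i) (a i))) ->
       polymod (mlinrec_ops (tensor M) a)},
     bijective f)
  /\ free_of_rank (mlinrec R^o a) (\prod_(i < p) d i)%N.
Proof.
split.
  pose T1 := tensor_ops (fun i => linrec_shift (M i) (a i)).
  pose T2 := mlinrec_ops (tensor M) a.
  (* [polymod] keeps the underlying module, so the [R]-linear map is reused and only linearity over
     the polynomials remains. *)
  pose f : polymod T1 -> polymod T2 := @to_mlinrec R p d a M.
  have fP : linear f by apply: polymod_linear; exact: to_mlinrec_shift.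
  pose f' : {linear polymod T1 -> polymod T2} :=
    HB.pack f (GRing.isLinear.Build _ (polymod T1) (polymod T2) *:%R f fP).
  exists f'; exists (@of_mlinrec R p d a M).
    exact: to_mlinrecK.
  exact: of_mlinrecK.
exact: mlinrec_free.
Qed.
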